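(* For every $n\in\mathbb{N}$ let $(X^n,L^n)$ be the quantum star graph with $n$ edges of lengths $L^n=(L^n_1,\dots,L^n_n)\in(0,\infty)^n$ and coupling parameter $\alpha=0$, where for each $n$ the entries of $L^n$ are linearly independent over $\mathbb{Q}$. Let $\tau:[1,\infty)\to\mathbb{R}$ be any function such that (a) $0\ge\tau(q)\ge 1-q$ for all $q\ge1$; (b) $\tau$ is convex; (c) $\frac{\tau(q)}{q}\ge\tau'(q)$ for all $q\ge 1$, where $\tau'$ is the right-sided derivative. Then there exist $k_n>0$, $n\in\mathbb{N}$, such that $k_n^2$ is an eigenvalue of $\Delta_{L^n}$ for every $n$ and the sequence of mass measures $(\mu_n^{k_n})_n$ has mass exponent $\tau$.
   Context: Quantum star graph: given $L=(L_1,\dots,L_n)\in(0,\infty)^n$, take $n$ intervals $[0,L_i]$ glued together at the endpoints $L_i$, which form the central vertex $v$; the endpoints $0$ are the exterior vertices. For $\alpha\in\mathbb{R}$, the operator $\Delta_L$ acts as $-d^2/dx^2$ on each edge, on functions $\varphi=(\varphi_i)_{1\le i\le n}\in\bigoplus_i H^2([0,L_i])$ satisfying: $\varphi_i(L_i)=\varphi_j(L_j)=:\varphi(v)$ for all $i,j$ (continuity at $v$); $\varphi_i(0)=0$ for all $i$ (Dirichlet condition); and $\sum_{i=1}^n\varphi_i'(L_i)=\alpha\,\varphi(v)$ ($\delta$-type condition with coupling parameter $\alpha$). This is a self-adjoint operator with discrete spectrum. Mass measures: an eigenfunction $\varphi^{\langle k\rangle}$ with eigenvalue $k^2$, $k>0$,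 has the form $\varphi^{\langle k\rangle}_i(x)=\alpha_i\sin kx$ on the $i$-th edge. Normalize it so that $\sum_{i=1}^n|\alpha_i|^2=1$. The associated mass measure is the probability measure on $\{1,\dots,n\}$ given by $\mu_n^k(i)=|\alpha_i|^2$. When the entries of $L$ are linearly independent over $\mathbb{Q}$, every eigenvalue is simple, so $\mu_n^k$ is determined by $k$. Mass exponent: for a sequence of probability measures $\mu_n$ on $\{1,\dots,n\}$, the mass exponent is $\tau(q)=\limsup_{n\to\infty}\frac{\log\sum_{i=1}^n\mu_n(i)^q}{\log n}$, $q\ge1$ (only $n\ge2$ is relevant). *)

(* Defs.v *)
From mathcomp Require Import all_boot all_order all_algebra.
From mathcomp Require Import complex.
From mathcomp Require Import all_classical all_reals all_analysis.

Set Implicit Arguments.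
Unset Strict Implicit.
Unset Printing Implicit Defensive.

Import Order.TTheory GRing.Theory Num.Theory.
Import numFieldNormedType.Exports.

Local Open Scope classical_set_scope.
Local Open Scope ring_scope.
Local Open Scope complex_scope.

(* f is absolutely continuous on [0, l] with (a.e.) derivative g *)
Definition ac_deriv (R : realType) (l : R) (f g : R -> R) : Prop :=
  lebesgue_measure.-integrable `[0, l] (EFin \o g) /\
  forall x : R, 0 <= x <= l ->
    f x = f 0 + \int[lebesgue_measure]_(t in `[0, x]) g t.

Definition square_integrable (R : realType) (l : R) (g : R -> R) : Prop :=
  measurable_fun `[0, l] g /\
  lebesgue_measure.-integrable `[0, l] (fun t => (g t ^+ 2)%:E).

(* f is (the C^1 representative of) an element of H^2([0, l]). On [0, l],
   f1 is its derivative (one-sided at the endpoints), which is determined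
   everywhere because ac_deriv makes f1 continuous; f2 is its second (weak)
   derivative, determined almost everywhere. *)
Definition H2_real (R : realType) (l : R) (f f1 f2 : R -> R) : Prop :=
  [/\ ac_deriv l f f1, ac_deriv l f1 f2 & square_integrable l f2].

Definition H2 (R : realType) (l : R) (f f1 f2 : R -> R[i]) : Prop :=
  H2_real l (fun x => complex.Re (f x)) (fun x => complex.Re (f1 x))
            (fun x => complex.Re (f2 x)) /\
  H2_real l (fun x => complex.Im (f x)) (fun x => complex.Im (f1 x))
            (fun x => complex.Im (f2 x)).

(* Graph of the operator: phi is in the domain of Delta_L and its image is psi.
   The i-th edge is [0, L i], with the central vertex at L i; c is phi(v). *)
Definition star_laplacian (R : realType) (n : nat) (alpha : R)
    (L : 'I_n -> R) (phi psi : 'I_n -> R -> R[i]) : Prop :=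
  exists d1 d2 : 'I_n -> R -> R[i],
    [/\ forall i, H2 (L i) (phi i) (d1 i) (d2 i),
        forall i, phi i 0 = 0,
        exists c : R[i],
          (forall i, phi i (L i) = c) /\
          \sum_(i < n) d1 i (L i) = alpha%:C * c &
        forall i, {ae lebesgue_measure, forall x : R,
          0 <= x <= L i -> psi i x = - d2 i x}].

(* Elements of the domain are continuous, so being nonzero in L^2 amounts to
   being nonzero at some point of some edge. *)
Definition star_eigenfunction (R : realType) (n : nat) (alpha : R)
    (L : 'I_n -> R) (lam : R) (phi : 'I_n -> R -> R[i]) : Prop :=
  star_laplacian alpha L phi (fun i x => lam%:C * phi i x) /\
  exists i : 'I_n, exists x : R, 0 <= x <= L i /\ phi i x != 0.

(* The operator is self-adjoint, so only real eigenvalues are considered. *)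
Definition star_eigenvalue (R : realType) (n : nat) (alpha : R)
    (L : 'I_n -> R) (lam : R) : Prop :=
  exists phi, star_eigenfunction alpha L lam phi.

(* A relation, since a multiple eigenvalue has several mass measures; mu is
   determined by k when the eigenvalue k^2 is simple. *)
Definition mass_measure (R : realType) (n : nat) (alpha : R)
    (L : 'I_n -> R) (k : R) (mu : 'I_n -> R) : Prop :=
  exists a : 'I_n -> R[i],
    [/\ star_eigenfunction alpha L (k ^+ 2) (fun i x => a i * (sin (k * x))%:C),
        \sum_(i < n) Normc.normc (a i) ^+ 2 = 1 &
        forall i, mu i = Normc.normc (a i) ^+ 2].

Definition lin_indep_rat (R : realType) (n : nat) (L : 'I_n -> R) : Prop :=
  forall c : 'I_n -> rat,
    \sum_(i < n) ratr (c i) * L i = 0 -> forall i, c i = 0.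

(* The terms n = 0, 1 (where ln n = 0) do not affect the limsup. *)
Definition mass_exponent (R : realType) (mu : forall n : nat, 'I_n -> R)
    (q : R) : \bar R :=
  limn_esup (fun n : nat =>
    (ln (\sum_(i < n) mu n i `^ q) / ln (n%:R : R))%:E).

(* Right-sided derivative; meaningful when the limit exists, which is the case
   in ]x0, +oo[ for a function convex on [x0, +oo[, and also at x0 if the
   difference quotients at x0 are bounded below. *)
Definition right_derivative (R : realType) (f : R -> R) (x : R) : R :=
  lim ((f (x + h) - f x) / h @[h --> 0^'+]).

(* Main.v *)
(* When no sin (k L_i) vanishes, k^2 is an eigenvalue for alpha = 0 as soon as the
   numbers d_i = cot (k L_i) sum to 0, and the mass of edge i is then proportional
   to 1/sin^2 = 1 + d_i^2. By Kronecker's theorem the vector (k L_i)_i comes close,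
   modulo pi, to any prescribed point, and since each cot (k L_i) decreases in k, a
   small change of k makes the d_i sum to 0 exactly: any c with sum 0 is attained
   up to an error 1.

   It remains to choose masses. The r-th largest one is, up to constants and
   normalization, w_r = inf_(q >= 1) (n^(tau q) / r)^(1/q). Then w_r^q <= n^(tau q) / r,
   so the q-th power sum exceeds n^(tau q) by at most a logarithmic factor.
   Conversely let f - a q be a line supporting tau at q0; condition (c) says f >= 0,
   and w_r >= n^(-a) for all r <= n^f, so that the power sum at q0 is at least of
   order n^(f - a q0) = n^(tau q0). *)

Require Import Defs.
From mathcomp Require Import all_boot all_order all_algebra.
From mathcomp Require Import complex.
From mathcomp Require Import all_classical all_reals all_analysis.
From mathcomp Require Import measurable_realfun.
From mathcomp Require Import ring lra zify.

Import Order.TTheory GRing.Theory Num.Theory.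
Import numFieldNormedType.Exports.

Set Implicit Arguments.
Unset Strict Implicit.
Unset Printing Implicit Defensive.

Local Open Scope classical_set_scope.
Local Open Scope ring_scope.
Local Open Scope complex_scope.

(** * Kronecker's theorem *)

Lemma normc_ge0 (R : realType) (z : R[i]) : 0 <= Normc.normc z.
Proof. by case: z => a b; exact: sqrtr_ge0. Qed.

Definition expi (R : realType) (x : R) : R[i] := cos x +i* sin x.

Lemma expi0 (R : realType) : expi (0 : R) = 1.
Proof. by rewrite /expi cos0 sin0. Qed.

Lemma expiD (R : realType) (x y : R) : expi (x + y) = expi x * expi y.
Proof.
by rewrite /expi sinD cosD /GRing.mul /=; congr Complex; rewrite [LHS]addrC.
Qed.

Lemma expi_sum (R : realType) (I : finType) (F : I -> R) :
  expi (\sum_i F i) = \prod_i expi (F i).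
Proof. exact: (big_morph _ (@expiD R) (expi0 R)). Qed.

Lemma expiMn (R : realType) (x : R) (m : nat) : expi (x *+ m) = expi x ^+ m.
Proof. by elim: m => [|m IH]; rewrite ?expi0// mulrS expiD IH exprS. Qed.

Lemma norm_expi (R : realType) (x : R) : `|expi x| = 1.
Proof. by rewrite normc_def /= cos2Dsin2 sqrtr1. Qed.

(** Since cos x = 1 - 2 sin^2 (x/2), the value 1 forces sin (x/2) = 0, and the bound puts x/2
    strictly between -pi and pi, where 0 is the only zero of the sine. *)
Lemma expi_eq1 (R : realType) (x : R) :
  `|x| < 2 * pi -> (expi x == 1) = (x == 0).
Proof.
move=> xpi; apply/eqP/eqP => [[]|->]; last exact: expi0.
have E y : cos (2 * y) = 1 - (sin y ^+ 2) *+ 2 :> R.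
  by rewrite mulr_natl cos_mulr2n cos2sin2; ring.
have -> : x = 2 * (x / 2) by field.
rewrite E => sx _.
have {}sx : sin (x / 2) = 0 by apply/eqP; rewrite -sqrf_eq0; apply/eqP; lra.
suff : x / 2 = 0 by move=> ->; rewrite mulr0.
move: xpi; rewrite ltr_norml => /andP[x1 x2].
have [x0|x0|->//] := ltgtP (x / 2) 0.
- have : 0 < sin (- (x / 2)) by apply: sin_gt0_pi; lra.
  by rewrite sinN sx oppr0 ltxx.
- have : 0 < sin (x / 2) by apply: sin_gt0_pi; lra.
  by rewrite sx ltxx.
Qed.

(* Bounded discrepancy is stronger than convergence of the averages; it holds
   for trigonometric polynomials and makes linearity immediate. *)
Definition has_mean (R : realType) (g : nat -> R[i]) (m : R[i]) : Prop :=
  exists B : R, forall M : nat, `|\sum_(s < M) g s - M%:R * m| <= B%:C.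

Lemma has_meanZ (R : realType) (g : nat -> R[i]) (m a : R[i]) :
  has_mean g m -> has_mean (fun s => a * g s) (a * m).
Proof.
move=> [B HB]; exists (Normc.normc a * B) => M.
rewrite -mulr_sumr mulrCA -mulrBr normrM rmorphM /=.
by apply: ler_wpM2l => //; exact: HB.
Qed.

Lemma has_mean_sum (R : realType) (I : finType) (g : I -> nat -> R[i])
    (m : I -> R[i]) :
  (forall i, has_mean (g i) (m i)) ->
  has_mean (fun s => \sum_i g i s) (\sum_i m i).
Proof.
move=> /choice[B HB]; exists (\sum_i B i) => M.
rewrite exchange_big mulr_sumr -sumrB rmorph_sum /=.
by apply: le_trans (ler_norm_sum _ _ _) _; apply: ler_sum => i _; exact: HB.
Qed.

(** For z != 1 the partial sums are geometric and bounded by 2 / |1 - z|, so only z = 1 contributes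
    to a mean. *)
Lemma has_mean_exp (R : realType) (z : R[i]) :
  `|z| = 1 -> has_mean (fun s => z ^+ s) (z == 1)%:R.
Proof.
move=> z1; have [->|zn1] := eqVneq z 1.
  exists 0 => M; rewrite (eq_bigr (fun=> 1)) => [|i _]; last by rewrite expr1n.
  by rewrite sumr_const card_ord mulr1 subrr normr0.
exists (2 / Normc.normc (1 - z)) => M; rewrite mulr0 subr0.
have E : (1 - z) * \sum_(s < M) z ^+ s = 1 - z ^+ M.
  by rewrite -[LHS]opprK -mulNr opprB -subrX1 opprB.
have nz : 1 - z != 0 by rewrite subr_eq0 eq_sym.
have -> : \sum_(s < M) z ^+ s = (1 - z ^+ M) / (1 - z).
  by rewrite -E mulrAC mulfV ?mul1r.
rewrite normrM normfV rmorphM fmorphV /= rmorph_nat.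
apply: ler_wpM2r; first by rewrite invr_ge0 ler0c normc_ge0.
by apply: le_trans (ler_normB _ _) _; rewrite normr1 normrX z1 expr1n.
Qed.

Lemma has_mean_le (R : realType) (g : nat -> R) (m r : R) :
  has_mean (fun s => (g s)%:C) m%:C -> (forall s, 0 <= g s <= r) -> m <= r.
Proof.
move=> [B HB] gr; rewrite leNgt; apply/negP => rm.
have H M : M%:R * (m - r) <= B.
  have := HB M; rewrite -rmorph_sum /= -(rmorph_nat (real_complex R)) -rmorphM -rmorphB /=.
  rewrite normc_def /= expr0n addr0 sqrtr_sqr lecR => /ler_normlP[_ _].
  have := HB M; rewrite -rmorph_sum /= -(rmorph_nat (real_complex R)) -rmorphM -rmorphB /=.
  rewrite normc_def /= expr0n addr0 sqrtr_sqr lecR => /ler_normlP[HM _].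
  have : \sum_(s < M) g s <= M%:R * r.
    rewrite mulr_natl -[M in _ *+ M]card_ord -sumr_const.
    by apply: ler_sum => s _; case/andP: (gr s).
  lra.
have := H (Num.bound `|B / (m - r)|).
rewrite -ler_pdivlMr ?subr_gt0// leNgt => /negP; apply.
by apply: le_lt_trans (ler_norm _) _; exact: archi_boundP (normr_ge0 _).
Qed.

(** Induction through (N+1) C(2N+2, N+1) = 2 (2N+1) C(2N, N). The bound makes the mean of cos^(2N)
    decay only polynomially in N. *)
Lemma expn4_le_central_bin (N : nat) : (4 ^ N <= (2 * N).+1 * 'C(2 * N, N))%N.
Proof.
elim: N => [//|N IH].
have E : (N.+1 * 'C(2 * N.+1, N.+1) = 2 * (2 * N).+1 * 'C(2 * N, N))%N.
  have e1 : (N.+1 * 'C((2 * N).+2, N.+1) = (2 * N).+2 * 'C((2 * N).+1, N))%N.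
    by rewrite mul_bin_diag.
  have e2 : (N.+1 * 'C((2 * N).+1, N) = (2 * N).+1 * 'C(2 * N, N))%N.
    have := mul_bin_down (2 * N).+1 N.
    by have -> : ((2 * N).+1 - N = N.+1)%N by lia.
  have -> : (2 * N.+1 = (2 * N).+2)%N by lia.
  nia.
rewrite expnS -(leq_pmul2l (ltn0Sn N)).
apply: (@leq_trans (N.+1 * (4 * ((2 * N).+1 * 'C(2 * N, N))))%N).
  by rewrite leq_mul2l /= leq_mul2l.
rewrite [leqRHS]mulnCA E; nia.
Qed.

(** Binomial expansion of ((e^(ix) + e^(-ix)) / 2)^(2N); j counts the factors e^(-ix), and the
    constant term is j = N. *)
Lemma cos_exp_expansion (R : realType) (N : nat) (x : R) :
  (cos x ^+ (2 * N))%:C = \sum_(j < (2 * N).+1)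
    (4 ^+ N)^-1 * 'C(2 * N, j)%:R * expi (((2 * N)%:R - (2 * j)%:R) * x).
Proof.
have -> : (cos x ^+ (2 * N))%:C = (4 ^+ N)^-1 * (expi x + expi (- x)) ^+ (2 * N).
  have -> : expi x + expi (- x) = 2 * (cos x)%:C.
    rewrite /expi cosN sinN mulr_natl mulr2n.
    by apply/eqP; rewrite eq_complex /= subrr addr0 !eqxx.
  have -> : 4 ^+ N = 2 ^+ (2 * N) :> R[i] by rewrite exprM; congr (_ ^+ _); ring.
  rewrite exprMn mulKf; last by rewrite expf_neq0 // pnatr_eq0.
  exact: rmorphXn.
rewrite [X in _ * X]exprDn mulr_sumr; apply: eq_bigr => j _.
rewrite -[X in _ * X = _]mulr_natl [LHS]mulrA; congr (_ * _).
rewrite -!expiMn -expiD; congr expi.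
have jN : (j <= 2 * N)%N by rewrite -ltnS.
rewrite mulrnBr // mulNrn -addrA -opprD mulrBl -[x *+ (2 * N)]mulr_natl; congr (_ - _).
by rewrite -mulrnDr addnn -mul2n mulr_natl.
Qed.


Lemma eventually_poly_exp (R : realType) (n : nat) (r : R) :
  0 <= r < 1 -> exists N : nat, (2 * N).+1%:R ^+ n * r ^+ N < 1.
Proof.
move=> /andP[r0 r1]; have [->|rn0] := eqVneq r 0.
  by exists 1%N; rewrite expr1 mulr0.
have rp : 0 < r by rewrite lt_neqAle eq_sym rn0.
have : 0 < - ln r by rewrite oppr_gt0 ln_lt0 // rp.
set a := - ln r => a0.
(* Here r^N = exp (- N a), while exp (N a) exceeds (N a)^(n+1) / (n+1)!. This beats (3N)^n >=
   (2N+1)^n as soon as N > K. *)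
set K : R := 3 ^+ n * (n.+1)`!%:R / a ^+ n.+1.
have K0 : 0 <= K by rewrite divr_ge0 ?mulr_ge0 ?exprn_ge0// ltW.
exists (Num.bound K).+1; set N := (Num.bound K).+1.
have NK : K < N%:R by apply: (lt_trans (archi_boundP K0)); rewrite ltr_nat.
have N0 : 0 < N%:R :> R by rewrite ltr0n.
have -> : r ^+ N = (expR (N%:R * a))^-1.
  by rewrite -expRN mulrN opprK expRM_natl lnK// posrE.
rewrite ltr_pdivrMr ?expR_gt0// mul1r.
apply: lt_le_trans (expR_ge1Dxn n _); last by rewrite mulr_ge0 // ltW.
apply: (@le_lt_trans _ _ (3 ^+ n * N%:R ^+ n)).
  rewrite -exprMn lerXn2r ?nnegrE ?mulr_ge0 //.
  by rewrite -natrM ler_nat /N; lia.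
apply: (@lt_trans _ _ ((N%:R * a) ^+ n.+1 / (n.+1)`!%:R)); last by rewrite ltrDr.
rewrite ltr_pdivlMr ?ltr0n ?fact_gt0// exprMn.
move: NK; rewrite /K ltr_pdivrMr ?exprn_gt0 // => NK.
have -> : 3 ^+ n * N%:R ^+ n * (n.+1)`!%:R = N%:R ^+ n * (3 ^+ n * (n.+1)`!%:R) :> R.
  by rewrite mulrAC mulrC.
by rewrite [N%:R ^+ n.+1]exprSr -mulrA ltr_pM2l ?exprn_gt0.
Qed.

(** Expanding the product gives exponentials in the sampling index s, one for each choice [f] of a
    binomial term per edge. Linear independence leaves a single zero frequency, the choice j = N on
    every edge, and its coefficient is the mean. *)
Lemma mean_prod_cos (R : realType) (n : nat) (L th : 'I_n -> R) (N : nat) :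
  lin_indep_rat L ->
  exists h : R, 0 < h /\
    has_mean (fun s => (\prod_i cos (s%:R * h * L i - th i) ^+ (2 * N))%:C)
             ((('C(2 * N, N)%:R / 4 ^+ N) ^+ n)%:C).
Proof.
move=> indep.
pose c (j : 'I_(2 * N).+1) : R := (2 * N)%:R - (2 * j)%:R.
pose lam (f : {ffun 'I_n -> 'I_(2 * N).+1}) := \sum_i c (f i) * L i.
pose b (j : 'I_(2 * N).+1) : R[i] := (4 ^+ N)^-1 * 'C(2 * N, j)%:R.
have NN : (N < (2 * N).+1)%N by lia.
pose f0 : {ffun 'I_n -> 'I_(2 * N).+1} := [ffun=> Ordinal NN].
have lam0 f : lam f = 0 -> f = f0.
  move=> lf; apply/ffunP => i; rewrite ffunE; apply/val_inj => /=.
  have := indep (fun i => (2 * N)%:R - (2 * f i)%:R).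
  rewrite (eq_bigr (fun i => c (f i) * L i)) => [|j _]; last first.
    by rewrite rmorphB /= !ratr_nat.
  move=> /(_ lf i) /eqP; rewrite subr_eq0 eqr_nat => /eqP; lia.
(* The sampling step is small enough that |h * lam f| < 2 pi for all [f], so no nonzero frequency is
   aliased to 0. *)
pose h : R := 2 * pi / (1 + \sum_f `|lam f|).
have S0 : 0 < 1 + \sum_f `|lam f| by rewrite ltr_pwDl // sumr_ge0.
have h0 : 0 < h by rewrite divr_gt0 // mulr_gt0 // pi_gt0.
exists h; split => //.
pose K (f : {ffun 'I_n -> 'I_(2 * N).+1}) : R[i] :=
  \prod_i (b (f i) * expi (- (c (f i) * th i))).
pose z f := expi (h * lam f).
have -> : (fun s : nat => (\prod_i cos (s%:R * h * L i - th i) ^+ (2 * N))%:C) =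
          (fun s => \sum_f K f * z f ^+ s).
  apply/funext => s; rewrite rmorph_prod /=.
  under eq_bigr do rewrite cos_exp_expansion.
  rewrite bigA_distr_bigA /=; apply: eq_bigr => f _.
  rewrite /z mulr_sumr expi_sum -prodrXl -big_split /=; apply: eq_bigr => i _.
  rewrite -[RHS]mulrA -expiMn -expiD; congr (_ * expi _).
  by rewrite -mulr_natr /c; ring.
have -> : (('C(2 * N, N)%:R / 4 ^+ N) ^+ n)%:C = \sum_f K f * (z f == 1)%:R.
  rewrite (bigD1 f0) //= big1 => [|f ff0].
    have l0 : lam f0 = 0.
      by rewrite /lam big1 // => i _; rewrite ffunE /c /= subrr mul0r.
    rewrite /z l0 mulr0 expi0 eqxx mulr1 addr0 /K.
    rewrite (eq_bigr (fun=> b (Ordinal NN))) => [|i _]; last first.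
      by rewrite ffunE /c /= subrr mul0r oppr0 expi0 mulr1.
    rewrite prodr_const card_ord /b rmorphXn rmorphM fmorphV rmorphXn /=.
    by rewrite !rmorph_nat mulrC.
  rewrite /z expi_eq1; last first.
    rewrite normrM gtr0_norm // /h mulrAC ltr_pdivrMr // ltr_pM2l ?mulr_gt0 ?pi_gt0 //.
    rewrite (bigD1 f) //= addrCA ltrDl ltr_pwDl // sumr_ge0 //.
  rewrite mulf_eq0 gt_eqF //=.
  case: eqP => [/lam0 E|]; last by rewrite mulr0.
  by rewrite E eqxx in ff0.
apply: has_mean_sum => f; apply: has_meanZ; apply: has_mean_exp.
exact: norm_expi.
Qed.

(* The mean of the product of the cos^(2N) decays polynomially in N, whereas the
   product would be at most r^N everywhere if no such t existed. *)
Theorem kronecker_cos (R : realType) (n : nat) (L th : 'I_n -> R) (r : R) :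
  lin_indep_rat L -> 0 <= r < 1 ->
  exists t : R, 0 <= t /\ forall i, r < cos (t * L i - th i) ^+ 2.
Proof.
move=> indep r01; apply/not_existsP => noT.
have [N HN] := eventually_poly_exp n r01.
have [h [h0 hm]] := mean_prod_cos th N indep.
case/andP: r01 => r0 r1.
have gr : forall s : nat,
    0 <= \prod_i cos (s%:R * h * L i - th i) ^+ (2 * N) <= r ^+ N.
  move=> s; rewrite prodr_ge0 => [|i _]; last by rewrite exprM exprn_ge0 ?sqr_ge0.
  have [i ir] : exists i, cos (s%:R * h * L i - th i) ^+ 2 <= r.
    apply: contrapT => /forallNP no; apply: (noT (s%:R * h)); split.
      by rewrite mulr_ge0 // ltW.
    by move=> i; rewrite ltNge; apply/negP/no.
  (* The factor of edge [i] is at most r^N and the others are at most 1. *)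
  rewrite (bigD1 i) //= -[leRHS]mulr1 ler_pM //.
  - by rewrite exprM exprn_ge0 ?sqr_ge0.
  - by rewrite prodr_ge0 // => j _; rewrite exprM exprn_ge0 ?sqr_ge0.
  - by rewrite exprM lerXn2r ?nnegrE ?sqr_ge0.
  rewrite prodr_ile1 // => j _; rewrite exprM exprn_ge0 ?sqr_ge0 //=.
  by rewrite exprn_ile1 ?sqr_ge0 // cos2sin2 gerBl sqr_ge0.
have := has_mean_le hm gr; apply/negP; rewrite -ltNge.
have d0 : 0 < (2 * N).+1%:R :> R by rewrite ltr0n.
rewrite -(@ltr_pM2l _ ((2 * N).+1%:R ^+ n)) ?exprn_gt0 //.
apply: lt_le_trans HN _; rewrite -exprMn exprn_ege1 // mulrA ler_pdivlMr ?exprn_gt0 //.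
by rewrite mul1r -natrX -natrM ler_nat expn4_le_central_bin.
Qed.

(** * Eigenfunctions of the star graph *)

Lemma continuous_is_derive (R : realType) (f g : R -> R) :
  (forall x : R, is_derive x 1 f (g x)) -> continuous f.
Proof.
move=> fg x; apply: differentiable_continuous; apply/derivable1_diffP.
exact: (@ex_derive _ _ _ _ _ _ _ (fg x)).
Qed.

Lemma ac_deriv_is_derive (R : realType) (l : R) (f g : R -> R) :
  continuous g -> (forall x : R, is_derive x 1 f (g x)) -> ac_deriv l f g.
Proof.
move=> cg fg; split.
  apply: continuous_compact_integrable; first exact: segment_compact.
  exact: continuous_subspaceT.
(* The fundamental theorem of calculus is applied on a nondegenerate interval, so x = 0 is treated
   apart. *)
move=> x /andP[x0 _]; have [<-|xn0] := eqVneq 0 x.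
  by rewrite set_itv1 Rintegral_set1 addr0.
have {xn0}x0 : 0 < x by rewrite lt_neqAle xn0.
have cf := continuous_is_derive fg.
rewrite /Rintegral (@continuous_FTC2 _ g f) //=; first ring.
- exact: continuous_subspaceT.
- split=> [y _||].
  + exact: (@ex_derive _ _ _ _ _ _ _ (fg y)).
  + by apply: cvg_at_right_filter; exact: cf.
  + by apply: cvg_at_left_filter; exact: cf.
- by move=> y _; rewrite derive1E; exact: (@derive_val _ _ _ _ _ _ _ (fg y)).
Qed.

Lemma H2_real_sin (R : realType) (l A k : R) :
  H2_real l (fun x => A * sin (k * x)) (fun x => A * k * cos (k * x))
    (fun x => - (k ^+ 2) * (A * sin (k * x))).
Proof.
have ds (B x : R) : is_derive x 1 (fun y => B * sin (k * y)) (B * k * cos (k * x)).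
  apply: is_derive_eq; rewrite /GRing.scale /=; ring.
have dc (B x : R) : is_derive x 1 (fun y => B * cos (k * y)) (- B * k * sin (k * x)).
  apply: is_derive_eq; rewrite /GRing.scale /=; ring.
have cs (B : R) := continuous_is_derive (ds B).
have cc (B : R) := continuous_is_derive (dc B).
have E : (fun x => - (k ^+ 2) * (A * sin (k * x))) =
         (fun x => - (k ^+ 2 * A) * sin (k * x)) by apply/funext => x; ring.
split.
- exact: ac_deriv_is_derive.
- apply: ac_deriv_is_derive; first by rewrite E.
  by move=> x; have := dc (A * k) x; congr is_derive; ring.
- rewrite E; split.
    by apply: measurable_funTS; exact: continuous_measurable_fun.
  apply: (@continuous_compact_integrable _ (fun t => (- (k ^+ 2 * A) * sin (k * t)) ^+ 2)).
    exact: segment_compact.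
  by apply: continuous_subspaceT => x; apply: cvgM; exact: cs.
Qed.

Lemma star_eigenfunction_sin (R : realType) (n : nat) (L : 'I_n -> R) (k : R)
    (a : 'I_n -> R[i]) (c : R[i]) :
  (forall i, 0 < L i) ->
  (forall i, a i * (sin (k * L i))%:C = c) ->
  \sum_i a i * (k * cos (k * L i))%:C = 0 ->
  c != 0 -> (0 < n)%N ->
  star_eigenfunction 0 L (k ^+ 2) (fun i x => a i * (sin (k * x))%:C).
Proof.
move=> L0 ac asum c0 n0; split; last first.
  exists (Ordinal n0), (L (Ordinal n0)).
  by rewrite lexx ltW //= ac.
exists (fun i x => a i * (k * cos (k * x))%:C).
exists (fun i x => - (k ^+ 2)%:C * (a i * (sin (k * x))%:C)).
split => [i|i||i].
- split.
  + have -> : (fun x => complex.Re (a i * (sin (k * x))%:C)) =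
              (fun x => complex.Re (a i) * sin (k * x)).
      by apply/funext => x; case: (a i) => u v /=; rewrite mulr0 subr0.
    have -> : (fun x => complex.Re (a i * (k * cos (k * x))%:C)) =
              (fun x => complex.Re (a i) * k * cos (k * x)).
      by apply/funext => x; case: (a i) => u v /=; rewrite mulr0 subr0 mulrA.
    have -> : (fun x => complex.Re (- (k ^+ 2)%:C * (a i * (sin (k * x))%:C))) =
              (fun x => - (k ^+ 2) * (complex.Re (a i) * sin (k * x))).
      by apply/funext => x; case: (a i) => u v /=; ring.
    exact: H2_real_sin.
  + have -> : (fun x => complex.Im (a i * (sin (k * x))%:C)) =
              (fun x => complex.Im (a i) * sin (k * x)).
      by apply/funext => x; case: (a i) => u v /=; ring.
    have -> : (fun x => complex.Im (a i * (k * cos (k * x))%:C)) =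
              (fun x => complex.Im (a i) * k * cos (k * x)).
      by apply/funext => x; case: (a i) => u v /=; ring.
    have -> : (fun x => complex.Im (- (k ^+ 2)%:C * (a i * (sin (k * x))%:C))) =
              (fun x => - (k ^+ 2) * (complex.Im (a i) * sin (k * x))).
      by apply/funext => x; case: (a i) => u v /=; ring.
    exact: H2_real_sin.
- by rewrite mulr0 sin0 mulr0.
- by exists c; split => //; rewrite mul0r.
- by apply: aeW => x _; rewrite mulNr opprK.
Qed.

(** Amplitudes proportional to 1 / sin (k L_i) give all edges the same nonzero value at the central
    vertex. The derivative condition then says that the cotangents sum to 0, and 1 / sin^2 = 1 +
    cot^2 gives the masses. *)
Lemma mass_measure_cot (R : realType) (n : nat) (L : 'I_n -> R) (k : R) :
  (forall i, 0 < L i) -> (0 < n)%N ->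
  (forall i, sin (k * L i) != 0) ->
  \sum_i cos (k * L i) / sin (k * L i) = 0 ->
  mass_measure 0 L k (fun i => (1 + (cos (k * L i) / sin (k * L i)) ^+ 2) /
    \sum_j (1 + (cos (k * L j) / sin (k * L j)) ^+ 2)).
Proof.
move=> L0 n0 s0 cot0; set S := \sum_j _.
have S0 : 0 < S.
  rewrite /S (bigD1 (Ordinal n0)) //= ltr_pwDl //.
    by rewrite ltr_pwDl // sqr_ge0.
  by rewrite sumr_ge0 // => i _; rewrite addr_ge0 // sqr_ge0.
pose A i := (Num.sqrt S)^-1 / sin (k * L i).
have A2 i : A i ^+ 2 = (1 + (cos (k * L i) / sin (k * L i)) ^+ 2) / S.
  rewrite /A expr_div_n exprVn sqr_sqrtr ?(ltW S0) // expr_div_n cos2sin2.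
  by field; rewrite s0 gt_eqF.
have normA i : Normc.normc (A i)%:C ^+ 2 = A i ^+ 2.
  by rewrite /= expr0n addr0 sqrtr_sqr real_normK // num_real.
exists (fun i => (A i)%:C); split => [||i].
- apply: (@star_eigenfunction_sin _ _ _ _ _ ((Num.sqrt S)^-1)%:C) => // [i||].
  + by rewrite -rmorphM /= /A divfK.
  + rewrite (eq_bigr (fun i => ((Num.sqrt S)^-1 * k)%:C *
      (cos (k * L i) / sin (k * L i))%:C)) => [|i _]; last first.
      by rewrite -!rmorphM /= /A; congr (_%:C); ring.
    by rewrite -mulr_sumr -rmorph_sum /= cot0 mulr0.
  + by rewrite (inj_eq (@complexI R)) invr_eq0 sqrtr_eq0 -ltNge.
- under eq_bigr do rewrite normA A2.
  by rewrite -mulr_suml divff // gt_eqF.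
- by rewrite normA A2.
Qed.

(** The sign is that of (-1)^m. Only s^2 = 1 is recorded, as the sign cancels in cotangents. For
    negative m, the natural case is applied at the shifted point. *)
Lemma trig_shift_mulpi (R : realType) (m : int) : exists s : R, s ^+ 2 = 1 /\
  forall u : R, cos (u + m%:~R * pi) = s * cos u /\
                sin (u + m%:~R * pi) = s * sin u.
Proof.
have nat_case (p : nat) (u : R) :
    cos (u + p%:R * pi) = (-1) ^+ p * cos u /\
    sin (u + p%:R * pi) = (-1) ^+ p * sin u.
  elim: p => [|p [IHc IHs]]; first by rewrite mul0r addr0 !mul1r.
  have -> : u + p.+1%:R * pi = u + p%:R * pi + pi by rewrite -natr1; ring.
  by rewrite cosDpi sinDpi IHc IHs exprS; split; ring.
have sgn2 (p : nat) : ((-1) ^+ p) ^+ 2 = 1 :> R by rewrite sqrr_sign.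
case: m => p; first by exists ((-1) ^+ p); split => // u; exact: nat_case.
exists ((-1) ^+ p.+1); split => // u.
have [] := nat_case p.+1 (u + (Negz p)%:~R * pi).
have -> : u + (Negz p)%:~R * pi + p.+1%:R * pi = u :> R.
  by rewrite NegzE mulrNz -pmulrn; ring.
by move=> -> ->; rewrite !mulrA -expr2 sgn2 !mul1r.
Qed.

(** Converts the conclusion of [kronecker_cos] into closeness modulo pi: cos^2 has period pi and
    decreases in |y| on [0, pi/2]. Here [y] is [x] minus the nearest multiple of pi. *)
Lemma near_mulpi (R : realType) (x e : R) :
  0 < e -> cos e ^+ 2 < cos x ^+ 2 -> e <= pi / 2 ->
  exists y s : R, [/\ `|y| < e, s ^+ 2 = 1 &
    forall u, cos (x + u) = s * cos (y + u) /\ sin (x + u) = s * sin (y + u)].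
Proof.
move=> e0 cex epi; have p0 := pi_gt0 R.
pose m := Num.floor (x / pi + 1 / 2).
have [s [s2 shift]] := trig_shift_mulpi R m.
pose y := x - m%:~R * pi.
have /andP[m1 m2] := floor_itv (x / pi + 1 / 2); rewrite -/m intrD in m1 m2.
have xE : x = x / pi * pi by rewrite divfK // gt_eqF.
have y1 : y <= pi / 2 by rewrite /y {1}xE; nra.
have y2 : - (pi / 2) <= y by rewrite /y {1}xE; nra.
exists y, s; split => //; last first.
  move=> u; have [] := shift (y + u).
  by have -> : y + u + m%:~R * pi = x + u by rewrite /y; ring.
rewrite ltNge; apply/negP => ey; move: cex; apply/negP; rewrite -leNgt.
have [-> _] : cos x = s * cos y /\ sin x = s * sin y.
  by have := shift y; rewrite /y subrK.
have yp : `|y| <= pi / 2 by rewrite ler_norml y1 y2.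
rewrite exprMn s2 mul1r -(cos_norm y) ler_pXn2r // ?nnegrE.
- by rewrite leNgt ltr_cos ?in_itv /= -?leNgt //; apply/andP; split; lra.
- by apply: cos_ge0_pihalf; apply/andP; split; lra.
- by apply: cos_ge0_pihalf; apply/andP; split; lra.
Qed.

Lemma tan_near (R : realType) (c : R) : exists e : R, 0 < e /\
  forall z, `|z - atan c| < e -> - (pi / 2) < z < pi / 2 /\ `|tan z - c| <= 1.
Proof.
have cz : cos (atan c) != 0.
  by rewrite gt_eqF // cos_gt0_pihalf // atan_gtNpi2 atan_ltpi2.
have tc := continuous_tan cz.
have : \forall z \near atan c, - (pi / 2) < z < pi / 2 /\ `|tan z - c| <= 1.
  near=> z; split.
    apply/andP; split; near: z.
    - by apply: lt_nbhsr; exact: atan_gtNpi2.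
    - by apply: lt_nbhsl; exact: atan_ltpi2.
  near: z; move/cvgrPdist_le : tc => /(_ _ ltr01).
  by rewrite atanK; apply: filterS => z; rewrite distrC.
move=> /nbhs_ballP[e /= e0 he]; exists e; split => // z ze.
by apply: he; rewrite /ball /= distrC.
Unshelve. all: by end_near. Qed.

Lemma le_tan (R : realType) (x y : R) :
  - (pi / 2) < x -> x <= y -> y < pi / 2 -> tan x <= tan y.
Proof.
move=> x1 xy y1; rewrite leNgt ltr_tan ?in_itv /= -?leNgt //.
  by rewrite (lt_le_trans x1).
by rewrite x1 (le_lt_trans xy).
Qed.

(* The sum of the cotangents is decreasing in k away from its poles, so it
   vanishes close to any point where its terms are close to the c i. *)
Theorem exists_cot_near (R : realType) (n : nat) (L c : 'I_n -> R) :
  (forall i, 0 < L i) -> lin_indep_rat L -> \sum_i c i = 0 ->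
  exists k : R, [/\ 0 < k, forall i, sin (k * L i) != 0,
    \sum_i cos (k * L i) / sin (k * L i) = 0 &
    forall i, `|cos (k * L i) / sin (k * L i) - c i| <= 1].
Proof.
move=> L0 indep c0; have p0 := pi_gt0 R.
have [e he] := choice (fun i => tan_near (- c i)).
have e0 i : 0 < e i by case: (he i).
pose y i := atan (- c i).
(* One window half-width for k that serves all edges: 2 * eta * L i < e i. *)
pose eta := (1 + \sum_i 2 * L i / e i)^-1.
have Le0 i : 0 <= 2 * L i / e i by rewrite divr_ge0 ?mulr_ge0 // ltW.
have S0 : 0 < 1 + \sum_i 2 * L i / e i by rewrite ltr_pwDl // sumr_ge0.
have eta0 : 0 < eta by rewrite invr_gt0.
have etaL i : 2 * (eta * L i) < e i.
  rewrite mulrCA /eta mulrC ltr_pdivrMr // -ltr_pdivrMl // mulrC.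
  by rewrite (bigD1 i) //= addrCA ltrDl ltr_pwDl // sumr_ge0.
have nice i z : `|z - y i| <= 2 * (eta * L i) ->
    - (pi / 2) < z < pi / 2 /\ `|tan z + c i| <= 1.
  move=> zy; have [_ /(_ z)] := he i; rewrite opprK; apply.
  exact: le_lt_trans zy _.
have eL0 i : 0 < eta * L i by rewrite mulr_gt0.
(* Both points y i + 2 * eta * L i and y i - 2 * eta * L i lie in the interval ]-pi/2, pi/2[ of
   length pi. *)
have eL_pihalf i : eta * L i <= pi / 2.
  have [/andP[_ h1] _] : - (pi / 2) < y i + 2 * (eta * L i) < pi / 2 /\
      `|tan (y i + 2 * (eta * L i)) + c i| <= 1.
    by apply: nice; rewrite addrAC subrr add0r ger0_norm // mulr_ge0 // ltW.
  have [/andP[h2 _] _] : - (pi / 2) < y i - 2 * (eta * L i) < pi / 2 /\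
      `|tan (y i - 2 * (eta * L i)) + c i| <= 1.
    by apply: nice; rewrite addrAC subrr add0r normrN ger0_norm // mulr_ge0 // ltW.
  lra.
(* With this threshold, [kronecker_cos] places each t * L i - th i within eta * L i of a multiple of
   pi. *)
pose r := \big[Num.max/0]_i cos (eta * L i) ^+ 2.
have r01 : 0 <= r < 1.
  rewrite /r bigmax_ge_id /=; apply/bigmax_ltP; split => // i _.
  rewrite cos2sin2 gtrBl exprn_even_gt0 //= gt_eqF // sin_gt0_pi //.
  by have := eL0 i; have := eL_pihalf i; lra.
(* The window for k is centred at t + 2 * eta, which keeps k positive. At the centre k * L i is near
   pi / 2 + y i modulo pi, where the cotangent is - tan (y i) = c i. *)
pose th i := pi / 2 + y i - 2 * eta * L i.
have [t [t0 Ht]] := kronecker_cos th indep r01.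
have Hx i : exists ys : R * R, [/\ `|ys.1| < eta * L i, ys.2 ^+ 2 = 1 &
    forall u, cos (t * L i - th i + u) = ys.2 * cos (ys.1 + u) /\
              sin (t * L i - th i + u) = ys.2 * sin (ys.1 + u)].
  have cx : cos (eta * L i) ^+ 2 < cos (t * L i - th i) ^+ 2.
    by apply: le_lt_trans (Ht i); exact: le_bigmax.
  have [z [s [h1 h2 h3]]] := near_mulpi (eL0 i) cx (eL_pihalf i).
  by exists (z, s).
have {Hx}[ys Hys] := choice Hx.
(* Modulo pi this is k * L i - pi / 2. As the Kronecker error is below eta * L i, moving u from -
   eta to eta carries every z i u from below y i to above it, so the cotangent sum changes sign. *)
pose z i u := y i + (ys i).1 + u * L i.
have zy i u : - eta <= u <= eta -> `|z i u - y i| <= 2 * (eta * L i).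
  case: (Hys i) => /ltr_normlP[a1 a2] _ _ /andP[u1 u2].
  rewrite /z ler_norml; have := L0 i; nra.
pose k u := t + 2 * eta + u.
have kE i u : k u * L i = t * L i - th i + (y i + u * L i) + pi / 2.
  by rewrite /k /th; ring.
have cosz i u : - eta <= u <= eta -> 0 < cos (z i u).
  by move=> /(zy i)/nice[zb _]; exact: cos_gt0_pihalf.
have s0 i : (ys i).2 != 0.
  by case: (Hys i) => _ s2 _; rewrite -sqrf_eq0 s2 oner_eq0.
have sink i u : sin (k u * L i) = (ys i).2 * cos (z i u).
  rewrite kE sinDpihalf; case: (Hys i) => _ _ /(_ (y i + u * L i))[-> _].
  by congr (_ * cos _); rewrite /z; ring.
have cosk i u : cos (k u * L i) = - ((ys i).2 * sin (z i u)).
  rewrite kE cosDpihalf; case: (Hys i) => _ _ /(_ (y i + u * L i))[_ ->].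
  by congr (- (_ * sin _)); rewrite /z; ring.
have cotk i u : cos (k u * L i) / sin (k u * L i) = - tan (z i u).
  by rewrite cosk sink mulNr -mulf_div divff // mul1r.
pose F u := \sum_i - tan (z i u).
have cF : {within `[- eta, eta], continuous F}.
  apply: continuous_in_subspaceT => u; rewrite inE /= in_itv /= => ub.
  rewrite /F; apply: (cvg_big (op := +%R)) => [|i _]; first exact: add_continuous.
  apply: cvgN.
  apply: (@continuous_comp _ _ _ (z i) tan); last first.
    by apply: continuous_tan; rewrite gt_eqF // cosz.
  by apply: cvgD; [exact: cvg_cst|apply: cvgMl; exact: cvg_id].
have tany i : tan (y i) = - c i by rewrite /y atanK.
have eta_in : - eta <= eta <= eta by apply/andP; split; lra.
have neta_in : - eta <= - eta <= eta by apply/andP; split; lra.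
have F1 : 0 <= F (- eta).
  rewrite -c0; apply: ler_sum => i _; rewrite lerNr -tany.
  have [/andP[b1 b2] _] := nice _ _ (zy i _ neta_in).
  apply: le_tan => //; last exact: atan_ltpi2.
  by rewrite /z; case: (Hys i) => /ltr_normlP[a1 a2] _ _; lra.
have F2 : F eta <= 0.
  rewrite -c0; apply: ler_sum => i _; rewrite lerNl -tany.
  have [/andP[b1 b2] _] := nice _ _ (zy i _ eta_in).
  apply: le_tan => //; first exact: atan_gtNpi2.
  by rewrite /z; case: (Hys i) => /ltr_normlP[a1 a2] _ _; lra.
have [u] : exists2 u, u \in `[- eta, eta] & F u = 0.
  apply: IVT => //; first lra.
  by rewrite ge_min le_max F1 F2 orbT.
rewrite in_itv /= => ub Fu; exists (k u); split => [|i||i].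
- by rewrite /k; move: ub => /andP[u1 u2]; lra.
- by rewrite sink mulf_neq0 // gt_eqF // cosz.
- by rewrite -[RHS]Fu; apply: eq_bigr => i _; exact: cotk.
- rewrite cotk; have [_] := nice _ _ (zy i _ ub).
  by rewrite -normrN opprD.
Qed.

(** * Convexity and logarithmic estimates *)

(** Convexity with weight (z - y) / (z - x) on x, cleared of denominators so that slopes can be
    compared by linear arithmetic. *)
Lemma convex_function_three_points (R : realType) (f : R -> R) (x y z : R) :
  convex_function (`[1, +oo[%classic : set R^o) f ->
  1 <= x -> x < y -> y < z ->
  f y * (z - x) <= f x * (z - y) + f z * (y - x).
Proof.
move=> cf x1 xy yz; have zx : 0 < z - x by lra.
have t0 : 0 <= (z - y) / (z - x) by apply: divr_ge0; lra.
have t1 : (z - y) / (z - x) <= 1 by rewrite ler_pdivrMr //; lra.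
have xin : x \in (`[1, +oo[%classic : set R^o) by rewrite inE /= in_itv /= x1.
have zin : z \in (`[1, +oo[%classic : set R^o).
  by rewrite inE /= in_itv /= andbT; lra.
have := cf (Itv01 t0 t1) _ _ xin zin; rewrite !convRE /unstable.onem /=.
rewrite [X in f X <= _](_ : _ = y); last first.
  transitivity ((z - y) / (z - x) * x + (1 - (z - y) / (z - x)) * z) => //.
  by field; rewrite gt_eqF.
rewrite -(ler_pM2r zx) => /le_trans; apply.
rewrite le_eqVlt; apply/orP; left; apply/eqP.
by field; rewrite gt_eqF.
Qed.

(** The line has as slope the right derivative D at x, so a = - D and f = tau x - x D. Then f >= 0
    is the hypothesis on D. At q = 1, where tau vanishes, the line gives f <= - D, and D >= -1 gives
    f <= 1. *)
Lemma convex_support_line (R : realType) (tau : R -> R) (x : R) :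
  (forall q : R, 1 <= q -> 1 - q <= tau q <= 0) ->
  convex_function (`[1, +oo[%classic : set R^o) tau ->
  right_derivative tau x <= tau x / x -> 1 <= x ->
  exists f a : R, [/\ 0 <= f <= 1, f - a * x = tau x &
    forall q, 1 <= q -> f - a * q <= tau q].
Proof.
move=> tb tc + x1; have x0 : 0 < x by lra.
have tau1 : tau 1 = 0 by have /andP[] := tb _ (lexx 1); lra.
have C3 u v w := convex_function_three_points (x := u) (y := v) (z := w) tc.
pose s h := (tau (x + h) - tau x) / h.
(* At x = 1 this is the bound tau q >= 1 - q; for x > 1 the slope from 1 to x is already at least
   -1. It makes the right derivative exist at x = 1 too, as an infimum of monotone quotients. *)
have s_ge h : 0 < h -> -1 <= s h.
  move=> h0; rewrite /s ler_pdivlMr // mulN1r.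
  have [x1'|] := ltP 1 x; last first.
    move=> x1'; have -> : x = 1 by apply/eqP; rewrite eq_le x1 x1'.
    by rewrite tau1; have /andP[] := tb (1 + h) ltac:(lra); lra.
  have := C3 1 x (x + h) (lexx _) x1'; rewrite ltrDl tau1 => /(_ h0).
  by have /andP[t1 t2] := tb _ x1; nra.
have s_le y h : 1 <= y -> y < x -> 0 < h -> (tau x - tau y) / (x - y) <= s h.
  move=> y1 yx h0; rewrite /s ler_pdivrMr ?subr_gt0 // mulrAC ler_pdivlMr //.
  have := C3 y x (x + h) y1 yx; rewrite ltrDl => /(_ h0); lra.
have s_nd : {in Interval (BRight 0) +oo%O &, nondecreasing_fun s}.
  move=> h h' + _; rewrite in_itv /= andbT => h0.
  rewrite le_eqVlt => /predU1P[->//|hh']; have h'0 : 0 < h' by lra.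
  rewrite /s ler_pdivrMr // mulrAC ler_pdivlMr //.
  have := C3 x (x + h) (x + h') x1; rewrite ltrDl ltrD2l => /(_ h0 hh'); lra.
have lbs : has_lbound (s @` [set` Interval (BRight 0) +oo%O]).
  exists (-1) => _ [h /= + <-]; rewrite in_itv /= andbT => h0; exact: s_ge.
have -> : right_derivative tau x = inf (s @` [set` Interval (BRight 0) +oo%O]).
  by apply: cvg_lim => //; exact: (@nondecreasing_at_right_cvgr _ s 0 +oo%O).
set D := inf _ => Dx.
have ne : (s @` [set` Interval (BRight 0) +oo%O]) !=set0.
  by exists (s 1), 1; rewrite //= in_itv /= ltr01.
have D_ge : -1 <= D.
  by apply: lb_le_inf => // _ [h /= + <-]; rewrite in_itv /= andbT; exact: s_ge.
have D_le h : 0 < h -> D <= s h.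
  by move=> h0; apply: ge_inf => //; exists h; rewrite //= in_itv /= h0.
have D_left y : 1 <= y -> y < x -> (tau x - tau y) / (x - y) <= D.
  move=> y1 yx; apply: lb_le_inf => // _ [h /= + <-]; rewrite in_itv /= andbT.
  exact: s_le.
have line q : 1 <= q -> tau x - x * D - - D * q <= tau q.
  move=> q1; have [qx|xq|->] := ltgtP q x; last lra.
    have := D_left _ q1 qx; rewrite ler_pdivrMr ?subr_gt0 //; lra.
  have := D_le (q - x); rewrite subr_gt0 => /(_ xq).
  by rewrite /s ler_pdivlMr ?subr_gt0 // [x + (q - x)]addrC subrK; lra.
exists (tau x - x * D), (- D); split => //; last lra.
have := line 1 (lexx _); rewrite tau1.
move: Dx; rewrite ler_pdivlMr // => Dx l1.
by apply/andP; split; lra.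
Qed.

(** Each new term satisfies 1/m <= - ln (1 - 1/m) = ln m - ln (m - 1). *)
Lemma harmonic_sum_le (R : realType) (n : nat) : (0 < n)%N ->
  \sum_(i < n) (i.+1%:R)^-1 <= 1 + ln n%:R :> R.
Proof.
elim: n => // -[_ _|n IH _]; first by rewrite big_ord1 ln1 addr0 invr1.
rewrite big_ord_recr /=; apply: le_trans (lerD (IH isT) (lexx _)) _.
rewrite -addrA lerD2l.
have n2 : 0 < n.+2%:R :> R by rewrite ltr0n.
have -> : n.+1%:R = n.+2%:R * (1 + - n.+2%:R^-1) :> R.
  by rewrite mulrBr mulr1 divff ?gt_eqF // -(natr1 n.+1) addrK.
have i1 : n.+2%:R^-1 < 1 :> R by rewrite invf_lt1 // ltr1n.
rewrite lnM ?posrE ?subr_gt0 //.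
have := @le_ln1Dx R (- n.+2%:R^-1); rewrite ltrN2 => /(_ i1).
move: (ln n.+2%:R) (ln (1 - _)) => u v; move: (n.+2%:R^-1) => w; lra.
Qed.

(** The logarithm lies below its tangent of slope e, and e is chosen so that D e <= eta / 2. The
    other half of eta * ln n absorbs the constants once ln n >= C. *)
Lemma near_ln_ln_le (R : realType) (K D eta : R) : 0 <= D -> 0 < eta ->
  \forall n \near \oo, K + D * ln (1 + ln n%:R) <= eta * ln (n%:R : R).
Proof.
move=> D0 eta0; pose e := eta / (2 * (D + 1)).
have e0 : 0 < e by rewrite divr_gt0 //; lra.
have De : D * e <= eta / 2.
  rewrite /e mulrA ler_pdivrMr; last lra.
  by nra.
pose C := (K + D * (e - 1 - ln e)) / (eta / 2).
near=> n.
have n1 : 1 <= n%:R :> R by rewrite ler1n; near: n; exact: nbhs_infty_gt.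
have l0 : 0 <= ln n%:R :> R by exact: ln_ge0.
have lC : C <= ln n%:R.
  have Cn : expR C <= n%:R by near: n; exact: nbhs_infty_ger.
  by rewrite -[C]expRK ler_ln // posrE ?expR_gt0 //; lra.
have L1 : ln (1 + ln n%:R) <= e * (1 + ln n%:R) - 1 - ln e :> R.
  have y0 : 0 < e * (1 + ln n%:R) by rewrite mulr_gt0 //; lra.
  have : ln (1 + (e * (1 + ln n%:R) - 1)) <= e * (1 + ln n%:R) - 1 :> R.
    by apply: le_ln1Dx; lra.
  by rewrite addrC subrK lnM ?posrE //; lra.
move: lC; rewrite /C ler_pdivrMr; last lra.
move=> lC; have := ler_wpM2l D0 L1; nra.
Unshelve. all: by end_near. Qed.

(** * Masses with a prescribed exponent *)

Lemma sqr_le_near (R : realType) (x y : R) :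
  `|x - y| <= 1 -> x ^+ 2 <= 2 * y ^+ 2 + 2.
Proof.
move=> xy; have : (x - y) ^+ 2 <= 1 by rewrite -real_normK ?num_real // expr_le1.
by have := sqr_ge0 (2 * y - x); lra.
Qed.

(* With l = ln n, exp (log_mass tau l r) is the largest mass that each of r
   points can have when every sum of q-th powers is at most n^(tau q). *)
Definition log_mass (R : realType) (tau : R -> R) (l r : R) : R :=
  inf [set (tau q * l - ln r) / q | q in [set q : R | 1 <= q]].

Lemma log_mass_ge (R : realType) (tau : R -> R) (l r f a : R) :
  0 <= l -> (forall q, 1 <= q -> f - a * q <= tau q) -> ln r <= f * l ->
  - (a * l) <= log_mass tau l r.
Proof.
move=> l0 ft rf; apply: lb_le_inf; first by exists ((tau 1 * l - ln r) / 1), 1 => /=.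
move=> _ [q /= q1 <-]; rewrite ler_pdivlMr; last lra.
by have := ler_wpM2r l0 (ft q q1); nra.
Qed.

Lemma log_mass_le (R : realType) (tau : R -> R) (l r q : R) :
  0 <= l -> (forall q, 1 <= q -> 1 - q <= tau q <= 0) -> ln r <= l -> 1 <= q ->
  q * log_mass tau l r <= tau q * l - ln r.
Proof.
move=> l0 tb rl q1; rewrite mulrC -ler_pdivlMr; last lra.
apply: ge_inf; last by exists q.
(* The lower bound tau p >= 1 - p and ln r <= l bound the set below by - l, so [inf] is a genuine
   infimum. *)
exists (- l) => _ [p /= p1 <-]; rewrite ler_pdivlMr; last lra.
by have /andP[t1 _] := tb p p1; have := ler_wpM2r l0 t1; nra.
Qed.

(** Ranks are counted from the nearer end: [i] and [rev_ord i] share a rank, so they can carry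
    opposite cotangents. Each rank occurs at most twice, which costs only a constant factor. *)
Definition end_rank (n : nat) (i : 'I_n) : nat := (minn i (rev_ord i)).+1.

Lemma end_rank_le (n : nat) (i : 'I_n) : (end_rank i <= n)%N.
Proof. by rewrite /end_rank gtn_min ltn_ord. Qed.

Lemma ln_end_rank_le (R : realType) (n : nat) (i : 'I_n) :
  ln (end_rank i)%:R <= ln n%:R :> R.
Proof.
have n0 : (0 < n)%N by exact: leq_trans (ltn_ord i).
by rewrite ler_ln ?posrE ?ltr0n // ler_nat end_rank_le.
Qed.

Lemma sum_inv_end_rank_le (R : realType) (n : nat) : (0 < n)%N ->
  \sum_(i < n) (end_rank i)%:R^-1 <= 2 * (1 + ln n%:R) :> R.
Proof.
move=> n0; apply: (@le_trans _ _ (\sum_(i < n) (i.+1%:R^-1 + (rev_ord i).+1%:R^-1))).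
  apply: ler_sum => i _; rewrite /end_rank /minn.
  by case: ifP => _; rewrite ?lerDl ?lerDr.
rewrite big_split /= [X in _ + X](_ : _ = \sum_(i < n) (i.+1%:R^-1 : R)).
  by have := @harmonic_sum_le R n n0; lra.
by rewrite [RHS](reindex_inj rev_ord_inj).
Qed.

(* The mass of edge i is proportional to 1 + cot^2, and the factor n makes the
   term 1 negligible. Edges i and rev_ord i get opposite cotangents, to meet the
   vertex condition. *)
Definition target_cot (R : realType) (tau : R -> R) (n : nat) (i : 'I_n) : R :=
  ((i < rev_ord i)%N%:R - (rev_ord i < i)%N%:R) *
  Num.sqrt (n%:R * expR (log_mass tau (ln n%:R) (end_rank i)%:R)).

Lemma sum_target_cot (R : realType) (tau : R -> R) (n : nat) :
  \sum_(i < n) target_cot tau i = 0.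
Proof.
suff : \sum_(i < n) target_cot tau i = - \sum_(i < n) target_cot tau i by lra.
rewrite {1}(reindex_inj rev_ord_inj) -sumrN; apply: eq_bigr => i _.
by rewrite /target_cot /end_rank rev_ordK minnC -opprB mulNr.
Qed.

Lemma leq_half_mul3 (n : nat) : (1 < n)%N -> (n <= 3 * n./2)%N.
Proof.
rewrite -half_gt0 -{2}(odd_double_half n) -mul2n => h0.
by rewrite [(3 * _)%N](mulSn 2) leq_add2r (leq_trans _ h0) // leq_b1.
Qed.

Lemma ltn_rev_ord_half (n : nat) (i : 'I_n) : (i < n./2)%N -> (i < rev_ord i)%N.
Proof.
move=> i2 /=; rewrite ltn_subRL addSn -addnS.
apply: leq_trans (leq_add i2 i2) _.
by rewrite addnn -[leqRHS]odd_double_half leq_addl.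
Qed.

Section mass_bounds.
Variables (R : realType) (tau : R -> R) (n : nat) (d : 'I_n -> R).
Hypothesis tau_bound : forall q : R, 1 <= q -> 1 - q <= tau q <= 0.
Hypothesis n_gt0 : (0 < n)%N.
Hypothesis d_near : forall i, `|d i - target_cot tau i| <= 1.

Let N : R := n%:R.
Let w (i : 'I_n) := expR (log_mass tau (ln N) (end_rank i)%:R).
Let S := \sum_i (1 + d i ^+ 2).
Let mu (i : 'I_n) := (1 + d i ^+ 2) / S.

Let N_ge1 : 1 <= N. Proof. by rewrite ler1n. Qed.
Let N_gt0 : 0 < N. Proof. exact: lt_le_trans N_ge1. Qed.
Let l_ge0 : 0 <= ln N. Proof. exact: ln_ge0. Qed.
Let w_gt0 i : 0 < w i. Proof. exact: expR_gt0. Qed.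

Let Nw_ge1 i : 1 <= N * w i.
Proof.
have : - (1 * ln N) <= log_mass tau (ln N) (end_rank i)%:R.
  apply: (log_mass_ge (f := 1)) => // [q q1|]; last by rewrite mul1r ln_end_rank_le.
  by rewrite mul1r; case/andP: (tau_bound q1).
by rewrite mul1r -ler_expR expRN lnK ?posrE // -ler_pdivrMl ?mulr1.
Qed.

Let cot_sqr i : target_cot tau i ^+ 2 =
  ((i < rev_ord i)%N%:R - (rev_ord i < i)%N%:R) ^+ 2 * (N * w i).
Proof. by rewrite exprMn sqr_sqrtr // (le_trans ler01). Qed.

Let weight_le i : 1 + d i ^+ 2 <= 5 * (N * w i).
Proof.
have := cot_sqr i; have := Nw_ge1 i; have := sqr_le_near (d_near i).
have : (((i < rev_ord i)%N%:R - (rev_ord i < i)%N%:R) ^+ 2 : R) <= 1.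
  case: (i < rev_ord i)%N; case: (rev_ord i < i)%N;
    by rewrite ?subrr ?subr0 ?sub0r ?sqrrN ?expr1n ?expr0n /= ?ler01.
set s : R := (X in X <= 1); set c := target_cot tau i; set v := N * w i.
move=> s1 dc v1 cE; have cv : c ^+ 2 <= v by rewrite cE ler_piMl // (le_trans ler01).
lra.
Qed.

(** The restriction to the first half leaves out the middle edge for odd n, whose target is 0. *)
Let weight_ge (i : 'I_n) : (i < rev_ord i)%N -> N * w i / 3 <= 1 + d i ^+ 2.
Proof.
move=> ii; have := d_near i; rewrite distrC => /sqr_le_near; have := cot_sqr i.
rewrite ii ltnNge (ltnW ii) subr0 expr1n mul1r.
move=> <-.
have := sqr_ge0 (d i); lra.
Qed.

Let S_ge : N <= S.
Proof.
rewrite /N -[n in n%:R]card_ord -sumr_const /S.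
by apply: ler_sum => i _; rewrite lerDl sqr_ge0.
Qed.

Let w_powR (q : R) i : 1 <= q -> w i `^ q <= expR (tau q * ln N) / (end_rank i)%:R.
Proof.
move=> q1; rewrite /powR gt_eqF // expRK.
have r0 : 0 < (end_rank i)%:R :> R by rewrite ltr0n.
rewrite -[X in _ / X]lnK ?posrE // -expRN -expRD ler_expR.
by apply: log_mass_le => //; exact: ln_end_rank_le.
Qed.

Let tau1 : tau 1 = 0.
Proof. by have /andP[] := tau_bound (lexx 1); lra. Qed.

Let sum_w_powR (q : R) : 1 <= q ->
  \sum_i w i `^ q <= expR (tau q * ln N) * (2 * (1 + ln N)).
Proof.
move=> q1; apply: le_trans (ler_sum _ (fun i _ => w_powR i q1)) _.
by rewrite -mulr_sumr ler_pM2l ?expR_gt0 // sum_inv_end_rank_le.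
Qed.

(** The power sum bound at q = 1, where tau vanishes, controls the normalization up to a
    logarithm. *)
Let S_le : S <= 12 * N * (1 + ln N).
Proof.
apply: le_trans (ler_sum _ (fun i _ => weight_le i)) _.
rewrite -!mulr_sumr.
have := sum_w_powR (lexx 1); rewrite tau1 mul0r expR0 mul1r.
rewrite (eq_bigr w) => [|i _]; last by rewrite powRr1 // ltW.
have := N_ge1; have := l_ge0; nra.
Qed.

Let S_gt0 : 0 < S. Proof. exact: lt_le_trans S_ge. Qed.

Let mu_le i : mu i <= 6 * w i.
Proof.
rewrite ler_pdivrMr //; apply: le_trans (weight_le i) _.
by have := ler_wpM2l (ltW (w_gt0 i)) S_ge; have := Nw_ge1 i; lra.
Qed.

Let mu_ge (i : 'I_n) : (i < rev_ord i)%N -> w i / (36 * (1 + ln N)) <= mu i.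
Proof.
move=> ii; rewrite ler_pdivlMr // mulrAC ler_pdivrMr; last by have := l_ge0; lra.
have h1 := ler_wpM2l (ltW (w_gt0 i)) S_le; apply: le_trans h1 _.
have -> : w i * (12 * N * (1 + ln N)) = N * w i / 3 * (36 * (1 + ln N)) by field.
by apply: ler_wpM2r (weight_ge ii); have := l_ge0; lra.
Qed.

Lemma mass_powR_sum_le (q : R) : 1 <= q ->
  \sum_i mu i `^ q <= 6 `^ q * (expR (tau q * ln N) * (2 * (1 + ln N))).
Proof.
move=> q1; apply: le_trans (ler_wpM2l (powR_ge0 _ _) (sum_w_powR q1)).
rewrite mulr_sumr; apply: ler_sum => i _; rewrite -powRM //; last exact: ltW.
apply: ge0_ler_powR; rewrite ?nnegrE ?mu_le //; first lra.
- by rewrite divr_ge0 // ?(ltW S_gt0) // addr_ge0 // sqr_ge0.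
- by rewrite mulr_ge0 // ltW.
Qed.

Lemma mass_powR_sum_ge (q f a : R) : (1 < n)%N -> 1 <= q -> 0 <= f <= 1 ->
  f - a * q = tau q -> (forall p, 1 <= p -> f - a * p <= tau p) ->
  ((36 * (1 + ln N))^-1) `^ q * (expR (tau q * ln N) / 3) <= \sum_i mu i `^ q.
Proof.
move=> n1 q1 /andP[f0 f1] fa supp.
have l0 := l_ge0; have N1 := N_ge1; have Npos : 0 < N by lra.
pose x := expR (f * ln N).
have x1 : 1 <= x by rewrite -expR0 ler_expR mulr_ge0.
have xN : x <= N by rewrite -[leRHS]lnK ?posrE // ler_expR; nra.
(* The edges used have rank at most x = n^f and lie in the first half, where the rank is i + 1. As 1
   <= x <= n, both terms of the minimum are at least x / 3. Each such edge has w i >= n^(-a), and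
   n^(f - a q) = n^(tau q). *)
pose m := minn (Num.truncn x) n./2.
have x0 : 0 <= x by lra.
have /andP[m1 m2] := truncn_itv x0.
have mx : x / 3 <= m%:R.
  rewrite /m /minn; case: ifP => _.
    rewrite -natr1 in m2.
    have : 1 <= (Num.truncn x)%:R :> R.
      by rewrite ler1n truncn_gt0.
    lra.
  by have := leq_half_mul3 n1; rewrite -(@ler_nat R) natrM -/N; lra.
have mn : (m <= n)%N by rewrite (leq_trans (geq_minr _ _)) // -divn2 leq_div.
apply: (@le_trans _ _ (\sum_(i < n | (i < m)%N) mu i `^ q)); last first.
  rewrite [leRHS](bigID (fun i : 'I_n => (i < m)%N)) /= lerDl.
  by apply: sumr_ge0 => i _; exact: powR_ge0.
have C0 : 0 <= (36 * (1 + ln N))^-1 by rewrite invr_ge0; lra.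
pose b := (36 * (1 + ln N))^-1 `^ q * expR (- (a * ln N) * q).
apply: (@le_trans _ _ (\sum_(i < n | (i < m)%N) b)).
  rewrite -(big_ord_widen n (fun=> b) mn) sumr_const card_ord -[leRHS]mulr_natl /b.
  rewrite [leRHS]mulrCA; apply: ler_wpM2l; first exact: powR_ge0.
  have -> : tau q * ln N = f * ln N + - (a * ln N) * q by rewrite -fa; ring.
  by rewrite expRD -/x mulrAC; apply: ler_wpM2r; first exact: expR_ge0.
apply: ler_sum => i im.
have ii : (i < rev_ord i)%N.
  exact: ltn_rev_ord_half (leq_trans im (geq_minr _ _)).
have ir : end_rank i = i.+1 by rewrite /end_rank (minn_idPl (ltnW ii)).
have wi : expR (- (a * ln N)) <= w i.
  rewrite /w ler_expR; apply: (log_mass_ge (f := f)) => //.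
  rewrite ir -ler_expR lnK ?posrE // -/x; apply: le_trans m1.
  by rewrite ler_nat; apply: leq_trans im _; rewrite geq_minl.
apply: (@le_trans _ _ ((w i / (36 * (1 + ln N))) `^ q)); last first.
  apply: ge0_ler_powR; rewrite ?nnegrE ?mu_ge //; first lra.
  - by rewrite mulr_ge0 // ltW.
  - by rewrite divr_ge0 // ?(ltW S_gt0) // addr_ge0 // sqr_ge0.
rewrite mulrC powRM //; last exact: ltW.
apply: ler_wpM2l; first exact: powR_ge0.
have -> : expR (- (a * ln N) * q) = expR (- (a * ln N)) `^ q.
  by rewrite /powR gt_eqF ?expR_gt0 // expRK mulrC.
by apply: ge0_ler_powR; rewrite ?nnegrE ?expR_ge0 //; lra.
Qed.

End mass_bounds.

(** Both bounds on the power sum put its logarithm within (q + 1) (ln 36 + ln (1 + ln n)) of tau q *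
    ln n. This is o(ln n), so the limsup is a limit. *)
Lemma mass_exponent_of_near (R : realType) (tau : R -> R)
    (d : forall n : nat, 'I_n -> R) (q : R) :
  (forall p : R, 1 <= p -> 1 - p <= tau p <= 0) ->
  convex_function (`[1, +oo[%classic : set R^o) tau ->
  (forall p : R, 1 <= p -> right_derivative tau p <= tau p / p) ->
  (forall n i, `|d n i - target_cot tau i| <= 1) -> 1 <= q ->
  mass_exponent (fun n i => (1 + d n i ^+ 2) / \sum_j (1 + d n j ^+ 2)) q =
  (tau q)%:E.
Proof.
move=> tb tc td dn q1.
have [f [a [f01 fa supp]]] := convex_support_line tb tc (td q q1) q1.
rewrite /mass_exponent; set u := fun n : nat => _.
suff uq : u @ \oo --> (tau q)%:E.
  rewrite is_cvg_limn_esupE; first exact/cvg_lim.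
  by apply/cvg_ex; exists (tau q)%:E.
apply: cvg_EFin; first exact: nearW.
apply/cvgrPdist_le => /= eta eta0.
have q10 : 0 <= q + 1 by lra.
near=> n.
have n1 : (1 < n)%N by near: n; exact: nbhs_infty_gt.
have l0 : 0 < ln n%:R :> R by rewrite ln_gt0 // ltr1n.
have n0 : (0 < n)%N by exact: ltnW.
set s := \sum_i _.
have hi : s <= _ := mass_powR_sum_le tb n0 (dn n) q1.
have lo : _ <= s := mass_powR_sum_ge tb n0 (dn n) n1 q1 f01 fa supp.
have small : (q + 1) * ln 36 + (q + 1) * ln (1 + ln n%:R) <= eta * ln n%:R.
  by near: n; exact: near_ln_ln_le.
have y0 : 0 < 1 + ln n%:R :> R by lra.
have i0 : 0 < (36 * (1 + ln n%:R))^-1 :> R by rewrite invr_gt0 mulr_gt0.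
have e0 := expR_gt0 (tau q * ln n%:R).
have lopos : 0 < (36 * (1 + ln n%:R))^-1 `^ q * (expR (tau q * ln n%:R) / 3).
  by rewrite mulr_gt0 ?powR_gt0 // divr_gt0.
have s0 : 0 < s by exact: lt_le_trans lo.
have c36 c : 0 < c <= 36 -> ln c <= ln (36 : R).
  by case/andP=> ? ?; rewrite ler_ln // posrE.
have l2 : ln 2 <= ln (36 : R) by apply: c36; apply/andP; split; lra.
have l3 : ln 3 <= ln (36 : R) by apply: c36; apply/andP; split; lra.
have l6 : ln 6 <= ln (36 : R) by apply: c36; apply/andP; split; lra.
have l36 : 0 <= ln (36 : R) by rewrite ln_ge0 //; lra.
have ly : 0 <= ln (1 + ln n%:R) :> R by rewrite ln_ge0 //; lra.
have lnhi : ln s <= q * ln 6 + (tau q * ln n%:R + (ln 2 + ln (1 + ln n%:R))).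
  have hipos : 0 < 6 `^ q * (expR (tau q * ln n%:R) * (2 * (1 + ln n%:R))).
    by rewrite !mulr_gt0 ?powR_gt0.
  rewrite -ler_ln ?posrE // in hi; apply: le_trans hi _.
  by rewrite !lnM ?posrE ?mulr_gt0 ?powR_gt0 // ln_powR expRK.
have lnlo : q * - (ln 36 + ln (1 + ln n%:R)) + (tau q * ln n%:R - ln 3) <= ln s.
  rewrite -ler_ln ?posrE // in lo; apply: le_trans _ lo.
  by rewrite lnM ?posrE ?powR_gt0 ?divr_gt0 // ln_powR lnV ?posrE ?mulr_gt0 //
    lnM ?posrE // ln_div ?posrE // expRK.
have -> : tau q - ln s / ln n%:R = (tau q * ln n%:R - ln s) / ln n%:R.
  by field; rewrite gt_eqF.
rewrite normrM normfV (gtr0_norm l0) ler_pdivrMr //.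
apply: le_trans small; apply/ler_normlP; split; nra.
Unshelve. all: by end_near. Qed.

Unset Implicit Arguments.

Theorem theorem1p4 (R : realType) (L : forall n : nat, 'I_n -> R)
    (L_gt0 : forall (n : nat) (i : 'I_n), 0 < L n i)
    (L_indep : forall n : nat, lin_indep_rat (L n))
    (tau : R -> R)
    (tau_bound : forall q : R, 1 <= q -> 1 - q <= tau q <= 0)
    (tau_convex : convex_function (`[1, +oo[%classic : set R^o) tau)
    (tau_deriv : forall q : R, 1 <= q -> right_derivative tau q <= tau q / q) :
  exists (k : nat -> R) (mu : forall n : nat, 'I_n -> R),
    (forall n : nat, (0 < n)%N ->
       [/\ 0 < k n, star_eigenvalue 0 (L n) (k n ^+ 2) &
           mass_measure 0 (L n) (k n) (mu n)]) /\
    (forall q : R, 1 <= q -> mass_exponent mu q = (tau q)%:E).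
Proof.
have [k Hk] := choice (fun n =>
  exists_cot_near (L_gt0 n) (L_indep n) (sum_target_cot tau n)).
pose d n i := cos (k n * L n i) / sin (k n * L n i).
exists k, (fun n i => (1 + d n i ^+ 2) / \sum_j (1 + d n j ^+ 2)); split.
  move=> n n0; have [k0 s0 cot0 _] := Hk n.
  have mm := mass_measure_cot (L_gt0 n) n0 s0 cot0.
  by split=> //; case: (mm) => a [eig _ _]; eexists; exact: eig.
move=> q q1; apply: mass_exponent_of_near => // n i.
by have [_ _ _ near] := Hk n; exact: near.
Qed.
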